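(* Suppose a strongly regular graph $\Delta$ with parameters $(162,21,0,3)$ exists, and let $x\in\operatorname{Aut}(\Delta)$ have order $5$. Then $\operatorname{Fix}(x)\cong K_2$ and $a_1(x)=15$.
   Context: A strongly regular graph with parameters $(v,k,\lambda,\mu)$ is a finite simple $k$-regular graph on $v$ vertices in which any two adjacent vertices have exactly $\lambda$ common neighbours and any two distinct non-adjacent vertices have exactly $\mu$ common neighbours. For an automorphism $x$ of $\Delta$, $\operatorname{Fix}(x)$ is the subgraph induced on the vertices fixed by $x$, and $a_1(x)=|\{u\in V(\Delta):u\sim x(u)\}|$ is the number of vertices adjacent to their image under $x$. $K_2$ is the complete graph on two vertices. *)

(* Defs.v *)
From mathcomp Require Import all_boot all_fingroup.

Set Implicit Arguments.
Unset Strict Implicit.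
Unset Printing Implicit Defensive.

Record sgraph : Type := SGraph {
  vertex : finType;
  adj : rel vertex;
  adj_sym : symmetric adj;
  adj_irrefl : irreflexive adj
}.

Definition neighbours (G : sgraph) (u : vertex G) : {set vertex G} :=
  [set w | adj u w].

Definition strongly_regular (G : sgraph) (v k lambda mu : nat) : Prop :=
  [/\ #|vertex G| = v,
      forall u : vertex G, #|neighbours u| = k,
      forall u w : vertex G, adj u w ->
        #|neighbours u :&: neighbours w| = lambda
    & forall u w : vertex G, u != w -> ~~ adj u w ->
        #|neighbours u :&: neighbours w| = mu].

Definition graph_iso (G H : sgraph) : Prop :=
  exists2 f : vertex G -> vertex H,
    bijective f & forall u w, adj (f u) (f w) = adj u w.

Section Induced.

Variables (G : sgraph) (A : {set vertex G}).

Definition induced_adj : rel {u : vertex G | u \in A} :=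
  fun u w => adj (val u) (val w).

Lemma induced_adj_sym : symmetric induced_adj.
Proof. by move=> u w; apply: adj_sym. Qed.

Lemma induced_adj_irrefl : irreflexive induced_adj.
Proof. by move=> u; apply: adj_irrefl. Qed.

Definition induced : sgraph := SGraph induced_adj_sym induced_adj_irrefl.

End Induced.

Section Complete.

Variable n : nat.

Definition complete_adj : rel 'I_n := fun i j => i != j.

Lemma complete_adj_sym : symmetric complete_adj.
Proof. by move=> i j; rewrite /complete_adj eq_sym. Qed.

Lemma complete_adj_irrefl : irreflexive complete_adj.
Proof. by move=> i; rewrite /complete_adj eqxx. Qed.

Definition complete : sgraph := SGraph complete_adj_sym complete_adj_irrefl.

End Complete.

Section Automorphisms.

Variable G : sgraph.

Definition graph_Aut : {set {perm vertex G}} :=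
  [set x : {perm vertex G} | [forall u, forall w, adj (x u) (x w) == adj u w]].

Lemma graph_Aut_group_set : group_set graph_Aut.
Proof.
apply/group_setP; split.
  by rewrite inE; apply/'forall_forallP => u w; rewrite !perm1.
move=> x y; rewrite !inE => /'forall_'forall_eqP xA /'forall_'forall_eqP yA.
by apply/'forall_'forall_eqP => u w; rewrite !permM yA xA.
Qed.

Canonical graph_Aut_group : {group {perm vertex G}} := group graph_Aut_group_set.

Definition Fix (x : {perm vertex G}) : sgraph := induced ('Fix_'P[x])%g.

Definition a1 (x : {perm vertex G}) : nat :=
  #|[set u : vertex G | adj u (x u)]|.

End Automorphisms.

(* Main.v *)
Require Import Defs.
From mathcomp Require Import all_boot all_algebra all_fingroup.
From mathcomp Require Import cyclic pgroup sylow algC zify ring.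

(** Fix an automorphism [x] of order 5 and write [N v] for the neighbourhood of
    [v] and [F] for the set of fixed vertices.

    The fixed vertices. All orbits of [x] have length 1 or 5, so [#|F|] is 2 and
    every [#|N u :&: F|] with [u] fixed is 1 modulo 5 ([card_fix],
    [fix_deg_mod]), and the three common neighbours of two non-adjacent fixed
    vertices are fixed ([common_fix]). If some fixed vertex has a single fixed
    neighbour, a third fixed vertex would have to share three fixed neighbours
    with it, so [F] is an edge. Otherwise all fixed degrees are at least 6; the
    value 6 is impossible for a local reason ([fix_deg_neq6]), and degrees that
    are all at least 11 force [#|F| >= 49] ([fix_deg_ge]), whereas a vertex that
    [x] moves has at most three fixed neighbours, which forces [#|F| <= 42]
    ([card_fix_le]).

    The value of [a1] modulo 45. The adjacency matrix [A] satisfies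
    [A^2 + 3 A - 18 = 3 J]; its eigenvalues are 21, 3 and -6, and
    [E = (J / 9 + 3 - A) / 9] is the projector on the 56-dimensional eigenspace
    for -6. For the permutation matrix [P] of [x] and a root [t] of
    [t^2 + t = 1], that is, for [t = z + 1/z] with [z] a primitive fifth root of
    unity, the matrix
    [(2 + t (P + P^4) - (1 + t) (P^2 + P^3)) / 5] projects on the part where [P]
    has the eigenvalues [z] and [1/z]. It commutes with [E], so the product is
    idempotent and its trace, an explicit combination of 1, [t], [a1 x] and
    [a1 (x^2)], is a rank, hence a natural number ([golden_trace]). The two
    choices of [t] and the irrationality of the square root of 5 give
    [a1 (x^2) = a1 x] and [2 a1 x = -960] modulo 45 ([a1_values]).

    The upper bound. Let [F = {u, w}]. As there are no triangles, a vertex [z]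
    that is adjacent to [x z] or to [x^2 z] is adjacent to neither [u] nor [w],
    and [z] cannot be adjacent to both of its images. Only 120 vertices are
    adjacent to neither [u] nor [w], so [2 a1 x <= 120], and [a1 x] is 15 or 60.
    In the latter case the orbits of all 120 vertices are pentagons, and
    [pentagon_bound] yields [a1 x <= 40], a contradiction. *)

Set Implicit Arguments.
Unset Strict Implicit.
Unset Printing Implicit Defensive.

Import GRing.Theory Num.Theory.

(** * Neighbourhoods and their common parts *)

Section Graph.

Variable G : sgraph.
Hypothesis srg : strongly_regular G 162 21 0 3.

Implicit Types (a b c u w y z p : vertex G) (A B S : {set vertex G}).

Local Notation N := (@neighbours G).

Lemma in_nbr u w : (w \in N u) = adj u w.
Proof. by rewrite inE. Qed.

Lemma card_nbr u : #|N u| = 21.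
Proof. by case: srg. Qed.

Lemma no_triangle a b c : adj a b -> adj b c -> adj a c -> False.
Proof.
case: srg => _ _ adj0 _ ab bc ac.
have /eqP := adj0 a b ab; rewrite cards_eq0 => /eqP/setP/(_ c).
by rewrite !inE ac bc.
Qed.

Lemma card_common a b : a != b -> ~~ adj a b -> #|N a :&: N b| = 3.
Proof. by case: srg => _ _ _; apply. Qed.

Lemma adj_neq a b : adj a b -> a != b.
Proof. by apply: contraTneq => ->; rewrite adj_irrefl. Qed.

Lemma nbrs_nonadj c a b : adj c a -> adj c b -> ~~ adj a b.
Proof. by move=> ca cb; apply/negP => ab; apply: (no_triangle ca ab cb). Qed.

(** Both sides count the adjacent pairs in [A * B]. *)
Lemma sum_nbr_sym A B : \sum_(a in A) #|N a :&: B| = \sum_(b in B) #|N b :&: A|.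
Proof.
have cardE a S : #|N a :&: S| = \sum_(b in S) adj a b.
  rewrite -sum1_card (eq_bigl (fun b => (b \in S) && adj a b)); last first.
    by move=> b; rewrite !inE andbC.
  by rewrite big_mkcondr.
under eq_bigr do rewrite cardE.
under [RHS]eq_bigr do rewrite cardE.
rewrite exchange_big; apply: eq_bigr => b _; apply: eq_bigr => a _.
by rewrite adj_sym.
Qed.

(** Each vertex of [S] is reached from [p] by exactly three paths of length two.
    All lower and upper bounds on the number of fixed vertices come from this
    count. *)
Lemma sum_nbr_far p S : {in S, forall z, (z != p) && ~~ adj z p} ->
  \sum_(y in N p) #|N y :&: S| = 3 * #|S|.
Proof.
move=> farS; rewrite sum_nbr_sym mulnC -sum_nat_const.
by apply: eq_bigr => z /farS/andP[zp nzp]; rewrite card_common.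
Qed.

(** * The fixed vertices of an automorphism of order 5 *)

Section Automorphism.

Variable x : {perm vertex G}.
Hypothesis xA : x \in graph_Aut G.

Lemma adj_aut a b : adj (x a) (x b) = adj a b.
Proof. by move: xA; rewrite inE => /'forall_'forall_eqP. Qed.

Hypothesis ox : #[x]%g = 5.

Local Notation F := ('Fix_'P[x])%g.

Lemma in_fix u : (u \in F) = (x u == u).
Proof. by apply/afix1P/eqP. Qed.

Lemma card_fix_mod S : {in S, forall a, x a \in S} -> #|S :&: F| = #|S| %[mod 5].
Proof.
move=> stabS.
have p5 : (5.-group <[x]>)%g by rewrite /pgroup -orderE ox.
have actS : [acts <[x]>, on S | 'P]%g.
  rewrite gen_subG sub1set !inE; apply/andP; split => //.
  by apply/subsetP => a /stabS; rewrite inE.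
by rewrite (pgroup_fix_mod p5 actS) -afix_cycle.
Qed.

Lemma card_fix : #|F| = 2 %[mod 5].
Proof.
rewrite -[F]setTI card_fix_mod; last by move=> a; rewrite !inE.
by rewrite cardsT; case: srg => ->.
Qed.

Lemma fix_deg_mod u : u \in F -> #|N u :&: F| = 1 %[mod 5].
Proof.
rewrite in_fix => /eqP xu; rewrite card_fix_mod ?card_nbr // => a.
by rewrite !in_nbr -{2}xu adj_aut.
Qed.

(** The three common neighbours are permuted by [x], and an orbit of length 5 does
    not fit into a set of three. *)
Lemma common_fix u w : u \in F -> w \in F -> u != w -> ~~ adj u w ->
  N u :&: N w \subset F.
Proof.
rewrite !in_fix => /eqP xu /eqP xw uw nuw.
have c3 := card_common uw nuw; apply/setIidPl/eqP.
rewrite eqEcard subsetIl c3 /=.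
have: #|N u :&: N w :&: F| = #|N u :&: N w| %[mod 5].
  apply: card_fix_mod => a; rewrite !inE => /andP[ua wa].
  by rewrite -{1}xu -{1}xw !adj_aut ua.
have := subset_leq_card (subsetIl (N u :&: N w) F); rewrite !c3; lia.
Qed.

Lemma ex_nonfix : exists p, p \notin F.
Proof.
case: (pickP [pred p | p \notin F]) => [p /= ?|fixall]; first by exists p.
have x1 : x = 1%g.
  by apply/permP => a; rewrite perm1; have := fixall a; rewrite /= in_fix => /negbFE/eqP.
by move: ox; rewrite x1 order1.
Qed.

Lemma adj_aut_fix f p : f \in F -> adj f (x p) = adj f p.
Proof. by rewrite in_fix => /eqP xf; rewrite -{1}xf adj_aut. Qed.

(** A fixed neighbour of [p] is also a neighbour of [x p], so it is one of the at
    most three common neighbours of [p] and [x p]. *)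
Lemma nonfix_deg p : p \notin F -> #|N p :&: F| <= 3.
Proof.
rewrite in_fix eq_sym => pxp.
have sub : N p :&: F \subset N p :&: N (x p).
  apply/subsetP => f; rewrite !in_setI !in_nbr => /andP[pf fF].
  by rewrite pf adj_sym adj_aut_fix // adj_sym.
apply: leq_trans (subset_leq_card sub) _.
have [pa|npa] := boolP (adj p (x p)); last by rewrite card_common.
by case: srg => _ _ -> .
Qed.

(** Count the paths of length two from a moved vertex [p] to the fixed vertices
    that are not adjacent to [p]. At most three of the 21 middle vertices are
    fixed, and each of the others has at most three fixed neighbours. This gives
    [3 (#|F| - a) <= 21 a + 3 (21 - a)] for some [a <= 3]. *)
Lemma card_fix_le : #|F| <= 42.
Proof.
have [p pF] := ex_nonfix; have a3 := nonfix_deg pF.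
have far : {in F :\: N p, forall z, (z != p) && ~~ adj z p}.
  move=> z; rewrite in_setD in_nbr => /andP[npz zF].
  by rewrite [adj z p]adj_sym npz andbT; apply: contraNneq pF => <-.
have := sum_nbr_far far.
have : \sum_(y in N p) #|N y :&: (F :\: N p)| <= 18 * #|N p :&: F| + 63.
  rewrite (big_setID F) /= -[63]/(3 * 21) -(card_nbr p) -(cardsID F (N p)) mulnDr addnA -mulnDl.
  apply: leq_add.
    rewrite mulnC -sum_nat_const; apply: leq_sum => y _.
    by rewrite -[18+3](card_nbr y) subset_leq_card ?subsetIl.
  rewrite mulnC -sum_nat_const; apply: leq_sum => y.
  rewrite in_setD => /andP[/nonfix_deg yF _]; apply: leq_trans yF.
  by apply: subset_leq_card; rewrite setIS ?subsetDl.
have := cardsID (N p) F; rewrite setIC; lia.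
Qed.

(** Count the paths of length two from [u] to the fixed vertices at distance two,
    through the fixed neighbours of [u] only. *)
Lemma fix_deg_ge m u : u \in F -> {in F, forall w, m < #|N w :&: F|} ->
  m * #|N u :&: F| <= 3 * (#|F| - 1 - #|N u :&: F|).
Proof.
move=> uF degF; set W := F :\: (u |: N u).
have far : {in W, forall z, (z != u) && ~~ adj z u}.
  by move=> z; rewrite !inE negb_or [adj z u]adj_sym => /andP[].
have cW : #|W| = #|F| - 1 - #|N u :&: F|.
  have := cardsID (u |: N u) F; rewrite -/W setIUr cardsU.
  rewrite (setIidPr _) ?sub1set // cards1 [F :&: N u]setIC.
  suff -> : [set u] :&: (N u :&: F) = set0 by rewrite cards0; lia.
  apply/setP => z; rewrite !inE; case: eqP => // ->; by rewrite adj_irrefl.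
rewrite -cW -(sum_nbr_far far) (big_setID F) mulnC -sum_nat_const /=.
apply: leq_trans (leq_addr _ _); apply: leq_sum => w.
rewrite in_setI in_nbr => /andP[uw wF].
have -> : N w :&: W = (N w :&: F) :\ u.
  apply/setP => z; rewrite [in LHS]in_setI !in_setD in_nbr in_set1 in_setU1 in_setI !in_nbr.
  case wz: (adj w z); rewrite ?andbF ?andbT //=.
  suff -> : adj u z = false by rewrite orbF.
  by apply/negP => /(no_triangle uw wz).
have := cardsD1 u (N w :&: F); have := degF w wF.
by rewrite in_setI in_nbr adj_sym uw uF /= ; lia.
Qed.

(** Suppose that [u] has six fixed neighbours, and take a fixed [z] at distance two
    from [u]. The three fixed neighbours of [u] outside [N z] form a set [C].
    Every fixed neighbour [y] of [z] outside [N u] has three neighbours among the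
    six, none of them in [N z], hence is adjacent to all of [C]. There are at
    least three such [y], so two vertices of [C] have at least four common
    neighbours: [u] and these [y]. *)
Lemma fix_deg_neq6 u : u \in F -> {in F, forall w, 5 < #|N w :&: F|} ->
  #|N u :&: F| != 6.
Proof.
move=> uF degF; apply/eqP => d6.
have [w] : exists w, w \in N u :&: F by apply/card_gt0P; rewrite d6.
rewrite in_setI in_nbr => /andP[uw wF].
have [z] : exists z, z \in (N w :&: F) :\ u.
  apply/card_gt0P; have := cardsD1 u (N w :&: F); have := degF w wF; lia.
rewrite in_setD1 in_setI in_nbr => /and3P[zu wz zF].
have nuz : ~~ adj u z by apply: (@nbrs_nonadj w); rewrite // adj_sym.
have cuz : #|N u :&: N z| = 3 by rewrite card_common // eq_sym.
have cuzF : N u :&: N z \subset F by rewrite common_fix // eq_sym.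
pose C := (N u :&: F) :\: N z.
have cC : #|C| = 3.
  have := cardsID (N z) (N u :&: F).
  by rewrite setIAC (setIidPl cuzF) cuz d6 -/C; clear; lia.
pose Y := (N z :&: F) :\: N u.
have cY : 3 <= #|Y|.
  have := cardsID (N u) (N z :&: F); rewrite -/Y.
  have -> : N z :&: F :&: N u = N u :&: N z.
    by rewrite setIC setIA (setIidPl cuzF).
  have := degF z zF; rewrite cuz; clear; lia.
have YC y : y \in Y -> C \subset N y.
  rewrite in_setD in_setI !in_nbr => /and3P[nuy zy yF].
  have yu : u != y by apply: contraNneq nuz => ->; rewrite adj_sym.
  have cuy : #|N u :&: N y| = 3 by rewrite card_common.
  suff /eqP <- : N u :&: N y == C by apply: subsetIr.
  rewrite eqEcard cuy cC andbT; apply/subsetP => q quy.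
  have qF : q \in F by apply: (subsetP (common_fix uF yF yu nuy)).
  move: quy; rewrite !in_setI !in_setD !in_setI !in_nbr qF => /andP[-> yq].
  by rewrite !andbT; apply/negP => /(no_triangle zy yq).
have /card_gt1P[c1 [c2 [c1C c2C c12]]] : 1 < #|C| by rewrite cC.
have uC c : c \in C -> adj u c by rewrite in_setD in_setI !in_nbr => /and3P[].
have nc12 := nbrs_nonadj (uC _ c1C) (uC _ c2C).
have : u |: Y \subset N c1 :&: N c2.
  apply/subsetP => y; rewrite in_setU1 in_setI !in_nbr ![adj _ y]adj_sym.
  case/predU1P => [->|/YC/subsetP YCy]; first by rewrite !uC.
  by rewrite -!in_nbr !YCy.
move/subset_leq_card; rewrite card_common // cardsU1.
have -> : u \notin Y.
  by rewrite !in_setD !in_setI !in_nbr [adj z u]adj_sym (negPf nuz) andbF.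
by rewrite add1n ltnNge cY.
Qed.

Lemma ex_fix_edge : exists u w, adj u w /\ F = [set u; w].
Proof.
have [u0 u0F] : exists u, u \in F by apply/card_gt0P; have := card_fix; lia.
have [/exists_inP[u uF /eqP/eqP/cards1P[w dw]]|] := boolP [exists u in F, #|N u :&: F| == 1].
  have := set11 w; rewrite -dw in_setI in_nbr => /andP[uw wF].
  exists u, w; split=> //; apply/setP => z; rewrite !in_set2.
  apply/idP/idP => [zF|/orP[]/eqP-> //].
  rewrite orbC -implyNb; apply/implyP => zw; apply: contraT => zu.
  have nuz : ~~ adj u z.
    apply: contraNN zw => uz.
    by rewrite -in_set1 -dw in_setI in_nbr uz.
  rewrite eq_sym in zu.
  have := subset_leq_card (subsetIl [set w] (N z)).
  rewrite -{1}dw setIAC (setIidPl (common_fix uF zF zu nuz)) cards1.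
  by rewrite (card_common zu nuz).
rewrite negb_exists_in => /forall_inP deg1.
have deg6 : {in F, forall w, 5 < #|N w :&: F|}.
  by move=> w wF; have := fix_deg_mod wF; have := deg1 w wF; lia.
have deg11 : {in F, forall w, 10 < #|N w :&: F|}.
  move=> w wF; have := fix_deg_mod wF; have := deg6 w wF.
  by have := fix_deg_neq6 wF deg6; lia.
have := fix_deg_ge u0F deg11; have := card_fix_le; have := deg11 _ u0F; lia.
Qed.

Lemma fix_iso_K2 : graph_iso (Fix x) (complete 2).
Proof.
have [u [w [uw FE]]] := ex_fix_edge.
have wu : (w == u) = false by rewrite eq_sym (negPf (adj_neq uw)).
have valF (a : vertex (Fix x)) : (val a == u) || (val a == w).
  by rewrite -in_set2 -FE (valP a).
pose label v : 'I_2 := if v == u then ord0 else ord_max.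
exists (fun v : vertex (Fix x) => label (val v)).
  apply: inj_card_bij => [a b eqab|].
    apply: val_inj; move: eqab; rewrite /label.
    by case/orP: (valF a) => /eqP->; case/orP: (valF b) => /eqP->; rewrite ?eqxx ?wu.
  by rewrite card_sig card_ord [#|_|](_ : _ = #|F|) // FE cards2 (adj_neq uw).
move=> a b; rewrite (_ : adj a b = adj (val a) (val b)) //.
rewrite -[LHS]/(label (val a) != label (val b)) /label.
case/orP: (valF a) => /eqP->; case/orP: (valF b) => /eqP->;
by rewrite ?eqxx ?wu ?adj_irrefl ?uw // adj_sym uw.
Qed.

(** * Orbits that are pentagons *)

Lemma aut5 a : x (x (x (x (x a)))) = a.
Proof.
have /permP/(_ a) : (x ^+ 5 = 1)%g by rewrite -ox expg_order.
by rewrite !expgS expg0 !permM !perm1.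
Qed.

Lemma aut2_neq a : x a != a -> x (x a) != a.
Proof. by apply: contraNneq => xxa; rewrite -{2}[a]aut5 !xxa. Qed.

Lemma aut3_neq a : x a != a -> x (x (x a)) != a.
Proof.
move=> xa; apply: contraNneq (aut2_neq xa) => xxxa.
by rewrite -{2}[a]aut5 xxxa.
Qed.

Lemma pentagon_nonadj z : adj z (x z) -> ~~ adj z (x (x z)).
Proof. by move=> zxz; rewrite (@nbrs_nonadj (x z)) ?adj_aut // adj_sym. Qed.

Lemma fixed_nonadj c z : c \in F -> adj z (x z) -> ~~ adj c z.
Proof.
move=> cF zxz; apply/negP => cz.
by apply: (no_triangle cz zxz); rewrite adj_aut_fix.
Qed.

Section Pentagons.

Variables u w : vertex G.
Hypothesis uw : adj u w.
Hypothesis fixE : F = [set u; w].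
Hypothesis far_pentagon :
  {in ~: (N u :|: N w), forall z, adj z (x z) || adj z (x (x z))}.

Let M := (N u :\ w) :|: (N w :\ u).

(* For z adjacent to x z, the common neighbours outside the pentagon of z of the
   two vertices z and x^2 z, which are non-adjacent in it. *)
Let D z := (N z :&: N (x (x z))) :\ x z.

Lemma card_tips z : adj z (x z) -> #|D z| = 2.
Proof.
move=> zxz; have zx : x z != z by rewrite eq_sym adj_neq.
have nzz := pentagon_nonadj zxz.
have := cardsD1 (x z) (N z :&: N (x (x z))).
rewrite card_common // 1?eq_sym ?aut2_neq // in_setI !in_nbr zxz.
by rewrite [adj _ (x z)]adj_sym adj_aut zxz -/(D z) => -[].
Qed.

(** Let [y] be in [D z] but outside [M], so that its orbit is a pentagon as well. If
    [y] is adjacent to [x^2 y], then [y], [x^2 y] and [x^2 z] form a triangle. If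
    [y] is adjacent to [x y], then [z] and [x^4 y] are non-adjacent and have the
    four common neighbours [y], [x^3 y], [x z] and [x^4 z]. *)
Lemma tips_near z : adj z (x z) -> D z \subset M.
Proof.
move=> zxz; have zx : x z != z by rewrite eq_sym adj_neq.
apply/subsetP => y; rewrite in_setD1 in_setI !in_nbr => /and3P[yxz zy xxzy].
have Fz c : c \in F -> y != c.
  by move=> cF; apply: contraTneq zy => ->; rewrite adj_sym fixed_nonadj.
have [yu yw] : y != u /\ y != w by rewrite !Fz ?fixE ?set21 ?set22.
rewrite in_setU !in_setD1 yu yw -in_setU /=; apply: contraT => farY.
have /orP[yxy|yxxy] : adj y (x y) || adj y (x (x y)).
- by apply: far_pentagon; rewrite in_setC.
- pose p a := x (x (x (x a))).
  have xp a : x (p a) = a by apply: aut5.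
  have px a : p (x a) = a by apply: aut5.
  have adj_p a b : adj (p a) (p b) = adj a b by rewrite !adj_aut.
  clearbody p.
  have adj_back a : adj a (x a) -> adj a (p a).
    by move=> axa; rewrite -{1}[a]px adj_p adj_sym.
  have yx : x y != y by rewrite eq_sym adj_neq.
  have zpy : z != p y by apply: contraNneq yxz => ->; rewrite xp.
  have nzpy : ~~ adj z (p y).
    by rewrite (@nbrs_nonadj y) ?adj_back // adj_sym.
  have : y |: (p (p y) |: [set x z; p z]) \subset N z :&: N (p y).
    apply/subsetP => c; rewrite in_setI !in_nbr !in_setU1 in_set1.
    case/or4P => /eqP->.
    + by rewrite zy adj_sym adj_back.
    + by rewrite adj_p adj_back // -{1}[z]px -[x z]px !adj_p xxzy.
    + by rewrite zxz -[x z]px adj_p adj_sym.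
    + by rewrite adj_p [adj y z]adj_sym zy adj_back.
  move/subset_leq_card; rewrite card_common // !cardsU1 cards1 !in_setU1 !in_set1.
  have -> : (y == p (p y)) = false.
    by apply: contraNF (aut2_neq yx) => /eqP yppy; rewrite {1}yppy !xp.
  have -> : (y == p z) = false.
    apply: contraNF (pentagon_nonadj yxy) => /eqP yz.
    have zE : z = x y by rewrite yz xp.
    by move: xxzy; rewrite zE -adj_aut -adj_aut aut5.
  have -> : (p (p y) == x z) = false.
    apply: contraNF (pentagon_nonadj zxz) => /eqP yz.
    have yE : y = x (x (x z)) by rewrite -yz !xp.
    by move: zy; rewrite yE -adj_aut -adj_aut aut5 adj_sym.
  have -> : (p (p y) == p z) = false.
    apply: contraNF yxz => /eqP yz; apply/eqP.
    by rewrite -[z]xp -yz !xp.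
  have -> : (x z == p z) = false.
    by apply: contraNF (aut2_neq zx) => /eqP->; rewrite xp.
  by rewrite (negPf yxz).
- have xxy : adj (x (x y)) (x (x z)) by rewrite !adj_aut adj_sym.
  by case: (no_triangle yxxy xxy); rewrite adj_sym.
Qed.

(** Count the pairs [(z, y)] with [z] adjacent to [x z] and [y] in [D z]. Every [z]
    has two partners, all of them in [M]. For a given [y] in [M], with fixed
    neighbour [c], the vertex [z] is a common neighbour of [y] and [x^3 y] other
    than [c], so [y] occurs at most twice. *)
Lemma pentagon_bound : #|[set z | adj z (x z)]| <= 40.
Proof.
set T := [set z | adj z (x z)].
have cM : #|M| <= 40.
  have cN a b : adj a b -> #|N a :\ b| = 20.
    by move=> ab; have := cardsD1 b (N a); rewrite in_nbr ab card_nbr => -[].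
  by rewrite /M cardsU !cN ?leq_subr // adj_sym.
rewrite -(leq_pmul2r (isT : 0 < 2)) -sum_nat_const.
apply: (@leq_trans (\sum_(y in M) 2)); last first.
  by rewrite sum_nat_const leq_pmul2r.
rewrite (eq_bigr (fun z => \sum_(y in M) (y \in D z))); last first.
  move=> z; rewrite inE => zxz; rewrite -(card_tips zxz) -big_mkcondr sum1_card.
  by rewrite -[in LHS](setIidPr (tips_near zxz)); apply: eq_card => y; rewrite in_setI.
rewrite exchange_big; apply: leq_sum => y yM.
rewrite -big_mkcondr sum1_card.
have [c [cF cy yF]] : exists c, [/\ c \in F, adj c y & y \notin F].
  move: yM; rewrite /M fixE !inE => /orP[]/andP[yc cy].
    exists u; rewrite set21 cy negb_or yc andbT; split=> //.
    by apply: contraTneq cy => ->; rewrite adj_irrefl.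
  exists w; rewrite set22 cy negb_or yc; split=> //.
  by apply: contraTneq cy => ->; rewrite adj_irrefl.
have xy : x y != y by rewrite -in_fix.
have nyy : ~~ adj y (x (x (x y))).
  by rewrite (@nbrs_nonadj c) // !adj_aut_fix.
have := cardsD1 c (N y :&: N (x (x (x y)))).
rewrite card_common // 1?eq_sym ?aut3_neq // in_setI !in_nbr ![adj _ c]adj_sym.
rewrite !adj_aut_fix // cy => -[->]; apply: subset_leq_card.
apply/subsetP => z.
rewrite unfold_in /= /T /D inE in_setD1 in_setI !in_nbr => /and3P[zxz _].
case/andP=> zy xxzy; rewrite in_setD1 in_setI !in_nbr [adj y z]adj_sym zy /=.
rewrite adj_sym -[z in adj z _]aut5 !adj_aut xxzy andbT.
by apply: contraTneq zxz => ->; rewrite adj_aut_fix // adj_irrefl.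
Qed.
End Pentagons.

End Automorphism.
End Graph.

(** * Matrices indexed by a finite type *)

Local Open Scope ring_scope.

(** A rank factorization [E = C *m R] satisfies [R *m C = 1] when [E] is idempotent,
    and [C *m R] and [R *m C] have the same trace. *)
Lemma mxtrace_idem (K : fieldType) n (E : 'M[K]_n) :
  E *m E = E -> \tr E = (\rank E)%:R.
Proof.
move: (row_base E) (col_base E) (row_base_free E) (col_base_full E) (mulmx_base E).
move=> R C freeR fullC CR EE; suff rc : R *m C = 1%:M.
  by rewrite -[in LHS]CR mxtrace_mulC rc mxtrace1.
apply: (row_free_inj freeR); rewrite mul1mx.
apply: (row_full_inj fullC).
by rewrite !mulmxA -mulmxA CR.
Qed.

Local Close Scope ring_scope.

Section VertexMatrix.
Local Open Scope ring_scope.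

Variables (K : numFieldType) (V : finType) (n : nat) (h : 'I_n.+1 -> V).
Hypothesis bij_h : bijective h.

(** Indexing by ['I_n.+1] through a bijection, rather than by the elements of [V],
    gives these matrices a ring structure. *)
Definition vmx (f : V -> V -> K) : 'M[K]_n.+1 := \matrix_(i, j) f (h i) (h j).

Definition pmx (g : {perm V}) := vmx (fun a b => (g a == b)%:R).

Lemma vmx_trace f : \tr (vmx f) = \sum_v f v v.
Proof.
rewrite [RHS](reindex h (onW_bij _ bij_h)) /=.
by apply: eq_bigr => i _; rewrite mxE.
Qed.

Lemma vmxM f1 f2 : vmx f1 * vmx f2 = vmx (fun a b => \sum_c f1 a c * f2 c b).
Proof.
apply/matrixP => i j; rewrite !mxE [RHS](reindex h (onW_bij _ bij_h)) /=.
by apply: eq_bigr => k _; rewrite !mxE.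
Qed.

Lemma eq_vmx f1 f2 : (forall a b, f1 a b = f2 a b) -> vmx f1 = vmx f2.
Proof. by move=> f12; apply/matrixP => i j; rewrite !mxE. Qed.

Lemma sum_delta (F : V -> K) a : \sum_c (a == c)%:R * F c = F a.
Proof.
rewrite (bigD1 a) //= eqxx mul1r big1 ?addr0 // => c /negPf ca.
by rewrite eq_sym ca mul0r.
Qed.

Lemma sum_indicator (S : {set V}) : \sum_c (c \in S)%:R = #|S|%:R :> K.
Proof. by rewrite -natr_sum -big_mkcond sum1_card. Qed.

Lemma mul_pmx_vmx g f : pmx g * vmx f = vmx (fun a b => f (g a) b).
Proof. by rewrite vmxM; apply: eq_vmx => a b; rewrite sum_delta. Qed.

Lemma mul_vmx_pmx g f : vmx f * pmx g = vmx (fun a b => f a ((g^-1)%g b)).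
Proof.
rewrite vmxM; apply: eq_vmx => a b; rewrite -[RHS](sum_delta (f a)).
apply: eq_bigr => c _; rewrite mulrC; congr (_%:R * _).
by rewrite -[in RHS](inj_eq (@perm_inj _ g)) permKV eq_sym.
Qed.

Lemma pmx1 : pmx 1%g = 1.
Proof.
apply/matrixP => i j; rewrite !mxE perm1 inj_eq //; exact: bij_inj.
Qed.

Lemma pmxM g1 g2 : pmx (g1 * g2)%g = pmx g1 * pmx g2.
Proof. by rewrite mul_pmx_vmx; apply: eq_vmx => a b; rewrite permM. Qed.

Lemma pmxX g k : pmx (g ^+ k)%g = pmx g ^+ k.
Proof. by elim: k => [|k IH]; rewrite ?pmx1 // expgS exprS pmxM IH. Qed.

(** When [t = z + 1/z] for a primitive fifth root of unity [z], the number
    [- 1 - t] is [z^2 + 1/z^2], and this is the sum of the projectors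
    [(\sum_k z^(-k) g^k) / 5] for [z] and [1/z], written over a field that needs to
    contain only [t]. *)
Definition golden_mx (g : {perm V}) (t : K) :=
  5^-1 *: (2%:A + t *: (pmx g + pmx (g ^+ 4)%g)
           + (- 1 - t) *: (pmx (g ^+ 2)%g + pmx (g ^+ 3)%g)).

(** [golden_mx g t] is the value at the matrix of [g] of a polynomial [f / 5] such
    that [f * f = 5 f] modulo ['X^5 - 1] and [t^2 + t - 1]. *)
Lemma golden_idem (g : {perm V}) (t : K) : (g ^+ 5 = 1)%g -> t ^+ 2 = 1 - t ->
  golden_mx g t * golden_mx g t = golden_mx g t.
Proof.
rewrite /golden_mx => g5 t2.
pose f : {poly K} := 2%:P + t%:P * ('X + 'X^4) + (- 1 - t)%:P * ('X^2 + 'X^3).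
have t2P : t%:P ^+ 2 = 1 - t%:P :> {poly K} by rewrite -polyC_exp t2 polyCB.
have [q fq] : exists q, f * f = 5%:R * f + ('X^5 - 1) * q.
  (* q collects the multiples of 'X^5 - 1 left when the exponents 5 to 8 in the
     square of f are reduced modulo 5 *)
  exists (t%:P ^+ 2 * (2 + 'X^3) + 2 * t%:P * (- 1 - t%:P) * ('X + 'X^2)
          + (- 1 - t%:P) ^+ 2 * (2 + 'X)).
  have -> : f = 2 + t%:P * ('X + 'X^4) + (- 1 - t%:P) * ('X^2 + 'X^3).
    by rewrite /f rmorph_nat polyCB polyCN.
  ring: t2P.
have -> : 2%:A + t *: (pmx g + pmx (g ^+ 4)%g)
          + (- 1 - t) *: (pmx (g ^+ 2)%g + pmx (g ^+ 3)%g) = horner_mx (pmx g) f.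
  rewrite !pmxX /f; move: (2 : K) (- 1 - t) => c s.
  rewrite !rmorphD !rmorphM !rmorphD !rmorphXn /=.
  by rewrite horner_mx_X !horner_mx_C -!mulmxE !mul_scalar_mx scalemx1.
rewrite -scalerAl -scalerAr -rmorphM fq rmorphD !rmorphM rmorphB rmorphXn rmorph1.
rewrite /= horner_mx_X -pmxX g5 pmx1 subrr mul0r addr0.
have -> : horner_mx (pmx g) 5 = 5%:R by apply: rmorph_nat.
by rewrite mulr_natl -scaler_nat [5^-1 *: (5%:R *: _)]scalerA mulVf ?scale1r // pnatr_eq0.
Qed.

End VertexMatrix.

(** * The spectrum of the graph *)

Section Spectrum.
Local Open Scope ring_scope.

Variables (K : numFieldType) (G : sgraph).
Hypothesis srg : strongly_regular G 162 21 0 3.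
Variables (n : nat) (h : 'I_n.+1 -> vertex G).
Hypothesis bij_h : bijective h.

Local Notation N := (@neighbours G).
Local Notation vmx := (@vmx K (vertex G) n h).
Local Notation pmx := (@pmx K (vertex G) n h).

Let A := vmx (fun a b => (adj a b)%:R).
Let J := vmx (fun _ _ => 1).

(** The projector on the eigenspace of [A] for -6: its value is 0 on the all-one
    vector (eigenvalue 21) and on the eigenspace for 3. *)
Definition eigen_proj := 9^-1 *: (9^-1 *: J + 3 *: 1 - A).

Lemma sum_adjl (b : vertex G) : \sum_c (adj c b)%:R = 21%:R :> K.
Proof.
rewrite -(card_nbr srg b) -sum_indicator.
by apply: eq_bigr => c _; rewrite in_nbr adj_sym.
Qed.

Lemma sum_const : \sum_(c : vertex G) 1 = 162%:R :> K.
Proof. by rewrite sumr_const; case: srg => <-. Qed.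

Lemma sum_adj_adj (a b : vertex G) :
  \sum_c (adj a c)%:R * (adj c b)%:R = 3 + 18 * (a == b)%:R - 3 * (adj a b)%:R :> K.
Proof.
transitivity (#|N a :&: N b|%:R : K).
  rewrite -sum_indicator; apply: eq_bigr => c _.
  by rewrite in_setI !in_nbr -natrM mulnb [adj c b]adj_sym.
case: (eqVneq a b) => [->|ab]; first by rewrite setIid card_nbr // adj_irrefl /=; ring.
have [adjab|nab] := boolP (adj a b); last by rewrite card_common //=; ring.
by case: srg => _ _ -> //= _; ring.
Qed.

(** This is strong regularity: adjacent, equal and distinct non-adjacent vertices
    have 0, 21 and 3 common neighbours. *)
Lemma adj_mx_sqr : A * A = 3 *: J + 18 *: 1 - 3 *: A.
Proof.
rewrite vmxM //; apply/matrixP => i j; rewrite !mxE sum_adj_adj.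
by rewrite (inj_eq (bij_inj bij_h)) mulr1.
Qed.

Lemma J_adj : J * A = 21 *: J.
Proof.
rewrite vmxM //; apply/matrixP => i j; rewrite !mxE.
by under eq_bigr do rewrite mul1r; rewrite sum_adjl mulr1.
Qed.

Lemma adj_J : A * J = 21 *: J.
Proof.
rewrite vmxM //; apply/matrixP => i j; rewrite !mxE.
under eq_bigr do rewrite mulr1 adj_sym; by rewrite sum_adjl mulr1.
Qed.

Lemma J_sqr : J * J = 162 *: J.
Proof.
rewrite vmxM //; apply/matrixP => i j; rewrite !mxE.
by under eq_bigr do rewrite mul1r; rewrite sum_const mulr1.
Qed.

Lemma eigen_proj_idem : eigen_proj * eigen_proj = eigen_proj.
Proof.
rewrite /eigen_proj; set X := 9^-1 *: J + 3 *: 1 - A.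
have XJ : X * J = 0.
  rewrite /X !mulrDl mulNr -!scalerAl mul1r J_sqr adj_J.
  by apply/matrixP => i j; rewrite !mxE; field.
have XA : X * A = - (6 *: X).
  rewrite /X !mulrDl mulNr -!scalerAl mul1r J_adj adj_mx_sqr.
  by apply/matrixP => i j; rewrite !mxE; field.
rewrite -scalerAl -scalerAr; congr (_ *: _).
rewrite {2}/X mulrBr mulrDr -!scalerAr mulr1 XJ XA.
by apply/matrixP => i j; rewrite !mxE; field.
Qed.

Lemma eigen_proj_pmx_comm (g : {perm vertex G}) : g \in graph_Aut G ->
  pmx g * eigen_proj = eigen_proj * pmx g.
Proof.
move=> gA; rewrite /eigen_proj -scalerAl -scalerAr; congr (_ *: _).
rewrite mulrBr mulrBl !mulrDr !mulrDl -!scalerAr -!scalerAl mulr1 mul1r.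
have -> : pmx g * J = J * pmx g by rewrite mul_pmx_vmx // mul_vmx_pmx.
congr (_ - _); rewrite mul_pmx_vmx // mul_vmx_pmx //; apply: eq_vmx => a b.
by rewrite -{1}[b](permKV g) (adj_aut gA).
Qed.

Lemma trace_pmx_eigen_proj (g : {perm vertex G}) :
  \tr (pmx g * eigen_proj) = (18 + 3 * #|'Fix_'P[g]%g|%:R - (a1 g)%:R) / 9.
Proof.
rewrite /eigen_proj -scalerAr mxtraceZ mulrC; congr (_ / _).
rewrite mulrBr mulrDr -!scalerAr mulr1 mul_pmx_vmx // [pmx g * A]mul_pmx_vmx //.
rewrite mxtraceD [\tr (- _)]raddfN /= mxtraceD !mxtraceZ !vmx_trace //.
rewrite sum_const; congr (_ + _ * _ - _); first by field.
  rewrite -sum_indicator; apply: eq_bigr => c _; congr (_%:R).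
  by congr nat_of_bool; apply/eqP/afix1P.
rewrite /a1 -sum_indicator; apply: eq_bigr => c _.
by rewrite inE adj_sym.
Qed.

End Spectrum.

Lemma ex_ord_bij (T : finType) : 0 < #|T| -> exists n (h : 'I_n.+1 -> T), bijective h.
Proof.
case cT: #|T| => [//|n] _; exists n, (fun i => enum_val (cast_ord (esym cT) i)).
exists (fun a => cast_ord cT (enum_rank a)) => i.
  by rewrite enum_valK cast_ordKV.
by rewrite cast_ordK enum_rankK.
Qed.

(** The bijection [g] carries the vertices adjacent to their image under [g] onto
    those adjacent to their image under the inverse of [g]. *)
Lemma a1_inv (G : sgraph) (g : {perm vertex G}) : a1 g^-1%g = a1 g.
Proof.
rewrite /a1 -[RHS](card_imset _ (@perm_inj _ g)); apply: eq_card => v; rewrite inE.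
apply/idP/imsetP => [adjv | [b]]; last by rewrite inE => ? ->; rewrite permK adj_sym.
by exists ((g^-1)%g v); rewrite ?inE permKV // adj_sym.
Qed.

(** The exponent of 5 is odd on the left and even on the right, unless both sides
    vanish. *)
Lemma five_sqr x y : 5 * x ^ 2 = y ^ 2 -> y = 0.
Proof.
case: y => // y; case: x => [|x] eq5; first by move: eq5; rewrite exp0n // expnS.
by have := congr1 (logn 5) eq5; rewrite lognM ?expn_gt0 // !lognX logn_prime // eqxx; lia.
Qed.

(** * Integrality of traces *)

Section Order5.
Variables (G : sgraph) (x : {perm vertex G}).
Hypothesis srg : strongly_regular G 162 21 0 3.
Hypothesis xA : x \in graph_Aut G.
Hypothesis ox : #[x]%g = 5.

Lemma order_expg_lt5 k : 0 < k < 5 -> #[x ^+ k]%g = 5.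
Proof. by case: k => [|[|[|[|[|k]]]]] // _; rewrite orderXgcd ox. Qed.

Lemma card_fix_expg k : 0 < k < 5 -> #|'Fix_'P[x ^+ k]%g| = 2.
Proof.
move=> /order_expg_lt5 oxk.
have [u [w [uw ->]]] := ex_fix_edge srg (groupX k xA) oxk.
by rewrite cards2 (adj_neq uw).
Qed.

Lemma expg5 : (x ^+ 5 = 1)%g.
Proof. by rewrite -ox expg_order. Qed.

Lemma a1_expg4 : a1 (x ^+ 4)%g = a1 x.
Proof.
suff <- : (x^-1 = x ^+ 4)%g by apply: a1_inv.
by apply/eqP; rewrite eq_invg_mul -expgS; apply/eqP/expg5.
Qed.

Lemma a1_expg3 : a1 (x ^+ 3)%g = a1 (x ^+ 2)%g.
Proof.
suff <- : ((x ^+ 2)^-1 = x ^+ 3)%g by apply: a1_inv.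
by apply/eqP; rewrite eq_invg_mul -expgD; apply/eqP/expg5.
Qed.

Local Open Scope ring_scope.

(** The number [m] is the rank of the product of the projectors [golden_mx] and
    [eigen_proj]. The product of [x ^+ k] and [eigen_proj] has the trace 56 for
    [k = 0] and [(24 - a1 (x ^+ k)) / 9] for [0 < k < 5], and inverse powers have
    equal values of [a1]. *)
Lemma golden_trace (K : numFieldType) (t : K) : t ^+ 2 = 1 - t -> exists m : nat,
  45 * m%:R = 1008 + 2 * t * (24 - (a1 x)%:R) + 2 * (- 1 - t) * (24 - (a1 (x ^+ 2)%g)%:R).
Proof.
move=> t2.
have [n [h bij_h]] : exists n (h : 'I_n.+1 -> vertex G), bijective h.
  by apply: ex_ord_bij; case: srg => ->.
have FF := golden_idem bij_h expg5 t2; set F := golden_mx h x t in FF.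
set E := eigen_proj K h.
have commX k : pmx K h (x ^+ k)%g * E = E * pmx K h (x ^+ k)%g.
  by apply: eigen_proj_pmx_comm => //; apply: groupX.
have FE : F * E = E * F.
  move: E commX => E commX; have comm1 := commX 1%N; rewrite expg1 in comm1.
  rewrite /F /golden_mx -scalerAl -scalerAr; congr (_ *: _).
  by rewrite !(mulrDl, mulrDr) -!scalerAl -!scalerAr mul1r mulr1 !(mulrDl, mulrDr) !commX comm1.
have idem : (F * E) * (F * E) = F * E.
  by rewrite -mulrA [E * (F * E)]mulrA -FE -mulrA eigen_proj_idem // mulrA FF.
have trX k : (0 < k < 5)%N -> \tr (pmx K h (x ^+ k)%g * E) = (24 - (a1 (x ^+ k)%g)%:R) / 9.
  by move=> k5; rewrite trace_pmx_eigen_proj // card_fix_expg //; field.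
have tr1 := trX 1%N isT; rewrite expg1 in tr1.
have trE : \tr E = 56.
  rewrite -[E]mul1r -(pmx1 K bij_h) trace_pmx_eigen_proj //.
  have -> : 'Fix_'P[1]%g = [set: vertex G].
    by apply/setP => v; rewrite in_setT; apply/afix1P; rewrite /= apermE perm1.
  have -> : a1 (1%g : {perm vertex G}) = 0%N.
    by apply: eq_card0 => v; rewrite inE perm1 adj_irrefl.
  by rewrite cardsT; case: srg => -> *; field.
exists (\rank (F * E)%R); rewrite -(mxtrace_idem idem).
have -> : \tr (F * E) = (112 + 2 * t * (24 - (a1 x)%:R) / 9
                         + 2 * (- 1 - t) * (24 - (a1 (x ^+ 2)%g)%:R) / 9) / 5.
  move: (E) trE tr1 trX => E0 trE tr1 trX; set rhs := RHS.
  rewrite /F /golden_mx -scalerAl !mulrDl -!scalerAl mul1r !mulrDl !(mxtraceD, mxtraceZ).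
  by rewrite trE tr1 !trX // a1_expg4 a1_expg3 /rhs; field.
by field.
Qed.

(** Subtracting [golden_trace] for the two roots [(- 1 + s) / 2] and [(- 1 - s) / 2],
    where [s] is the square root of 5, gives
    [45 (m1 - m2) = 2 s (a1 (x^2) - a1 x)]; as [s] is irrational, both sides
    vanish. *)
Lemma a1_values :
  a1 x = a1 (x ^+ 2)%g /\ exists m : nat, (45 * m = 960 + 2 * a1 x)%N.
Proof.
pose s : algC := sqrtC 5; have s2 : s ^+ 2 = 5 by apply: sqrtCK.
have [|m1] := @golden_trace _ ((s - 1) / 2); first by field: s2.
have [|m2] := @golden_trace _ ((- s - 1) / 2); first by field: s2.
move: (a1 x) (a1 (x ^+ 2)%g) => a b e2 e1.
have a_b : a = b.
  have eqZ : 5 * (9 * (m1%:Z - m2%:Z)) ^+ 2 = (2 * (b%:Z - a%:Z)) ^+ 2.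
    apply: (@intr_inj algC).
    rewrite rmorphM !rmorphXn !rmorphM !rmorphB !rmorph_nat.
    have e12 : 45 * (m1%:R - m2%:R) = 2 * s * (b%:R - a%:R) :> algC.
      by rewrite mulrBr e1 e2; field.
    have -> : 5 * (9 * (m1%:R - m2%:R)) ^+ 2 = (45 * (m1%:R - m2%:R)) ^+ 2 / 5 :> algC.
      by field.
    by rewrite e12; field: s2.
  have := congr1 absz eqZ; rewrite abszM !abszX => /five_sqr; lia.
split=> //; exists m1; apply/eqP; rewrite -(eqr_nat algC) natrM natrD natrM e1 -a_b.
by apply/eqP; field.
Qed.

Local Close Scope ring_scope.

(** * Bounding the number of vertices adjacent to their image *)

Local Notation N := (@neighbours G).

Lemma card_far (u w : vertex G) : adj u w -> #|~: (N u :|: N w)| = 120.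
Proof.
move=> uw; have : N u :&: N w = set0.
  by apply: cards0_eq; case: srg => _ _ -> .
have := cardsC (N u :|: N w); rewrite cardsU !(card_nbr srg) => + uw0.
by rewrite uw0 cards0; case: srg => ->; lia.
Qed.

Lemma a1_eq15 : a1 x = 15.
Proof.
have [u [w [uw fixE]]] := ex_fix_edge srg xA ox.
have [a12 [m a1m]] := a1_values.
set T1 := [set z | adj z (x z)]; set T2 := [set z | adj z (x (x z))].
have T1E : #|T1| = a1 x by [].
have T2E : #|T2| = a1 x.
  by rewrite a12; apply: eq_card => z; rewrite !inE permM.
have uF : u \in 'Fix_'P[x]%g by rewrite fixE set21.
have wF : w \in 'Fix_'P[x]%g by rewrite fixE set22.
have far c z : c \in 'Fix_'P[x]%g -> z \in T1 :|: T2 -> ~~ adj c z.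
  move=> cF; rewrite !inE => /orP[/(fixed_nonadj srg xA cF) //|zxxz].
  apply/negP => cz; apply: (no_triangle srg cz zxxz).
  by rewrite !(adj_aut_fix xA).
have subT : T1 :|: T2 \subset ~: (N u :|: N w).
  by apply/subsetP => z zT; rewrite in_setC in_setU !in_nbr negb_or !far.
have disjT : T1 :&: T2 = set0.
  apply/eqP; rewrite -subset0; apply/subsetP => z; rewrite !inE.
  by case/andP=> /(pentagon_nonadj srg xA)/negPf->.
have cT : #|T1 :|: T2| = 2 * a1 x by rewrite cardsU disjT cards0 T1E T2E; lia.
have := subset_leq_card subT; rewrite card_far // cT => le60.
(* a1m and le60 leave the two values 15 and 60 *)
apply/eqP; apply: contraT => a15.
have a60 : a1 x = 60 by move: a1m le60 a15; clear; lia.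
have farT : {in ~: (N u :|: N w), forall z, adj z (x z) || adj z (x (x z))}.
  have -> : ~: (N u :|: N w) = T1 :|: T2.
    by apply/esym/eqP; rewrite eqEcard subT card_far // cT a60.
  by move=> z; rewrite !inE.
by have := pentagon_bound srg xA ox uw fixE farT; rewrite -/T1 T1E a60.
Qed.

End Order5.

Theorem proposition8p2 (Delta : sgraph)
    (srg : strongly_regular Delta 162 21 0 3)
    (x : {perm vertex Delta}) (xA : x \in graph_Aut Delta)
    (ox : #[x]%g = 5) :
  graph_iso (Fix x) (complete 2) /\ a1 x = 15.
Proof. by split; [apply: fix_iso_K2 | apply: a1_eq15]. Qed.
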